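(* Let $(\mathfrak{g}, [\cdot,\dots,\cdot])$ be an $n$-Lie superalgebra over a field $\mathbb{K}$ and let $S : \mathfrak{g} \to \mathbb{K}$ be a supertrace of $[\cdot,\dots,\cdot]$. Then the induced $(n+1)$-Lie superalgebra $(\mathfrak{g}_S, [\cdot,\dots,\cdot]_S)$ is solvable.
   Context: A super vector space is a direct sum $V = V_{\overline 0} \oplus V_{\overline 1}$; a nonzero element $x$ is homogeneous if $x \in V_{\overline 0}$ (parity $|x| = \overline 0$) or $x \in V_{\overline 1}$ (parity $|x| = \overline 1$). Whenever $|x|$ is written, $x$ is assumed homogeneous; identities involving parities are stated for homogeneous elements and extended by multilinearity. For $\mathrm{x} = (x_1, x_2, \dots)$ write $|\mathrm{x}|_i = \sum_{j=1}^{i} |x_j|$ (so $|\mathrm{x}|_0=\overline 0$). An $n$-Lie superalgebra ($n \ge 2$) is a super vector space $\mathfrak{g}$ over $\mathbb{K}$ with an $n$-linear map $[\cdot,\dots,\cdot] : \mathfrak{g}^n \to \mathfrak{g}$ such that (1) $|[x_1,\dots,x_n]| = \sum_{i=1}^n |x_i|$; (2) $[x_1,\dots,x_i,x_{i+1},\dots,x_n] = -(-1)^{|x_i||x_{i+1}|}[x_1,\dots,x_{i+1},x_i,\dots,x_n]$; (3) (graded Filippov identity) $[y_1,\dots,y_{n-1},[x_1,\dots,x_n]] = \sum_{i=1}^n (-1)^{|\mathrm{x}|_{i-1}|\mathrm{y}|_{n-1}} [x_1,\dots,x_{i-1},[y_1,\dots,y_{n-1},x_i],x_{i+1},\dots,x_n]$.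 A supertrace of $[\cdot,\dots,\cdot]$ is a linear map $S:\mathfrak{g}\to\mathbb{K}$ with $S([x_1,\dots,x_n]) = 0$ for all $x_1,\dots,x_n\in\mathfrak{g}$ and $S(x)=0$ for all $x \in \mathfrak{g}_{\overline 1}$. The induced bracket $[\cdot,\dots,\cdot]_S:\mathfrak{g}^{n+1}\to\mathfrak{g}$ is $$[x_1,\dots,x_{n+1}]_S = \sum_{i=1}^{n+1} (-1)^{i-1}(-1)^{|x_i||\mathrm{x}|_{i-1}} S(x_i)[x_1,\dots,x_{i-1},x_{i+1},\dots,x_{n+1}].$$ The super vector space $\mathfrak{g}$ with this bracket is denoted $\mathfrak{g}_S$; it is known to be an $(n+1)$-Lie superalgebra, called the induced $(n+1)$-Lie superalgebra. A subspace $\mathfrak{h}$ of a $k$-Lie superalgebra is an ideal if $[h,x_1,\dots,x_{k-1}]\in\mathfrak{h}$ for all $h\in\mathfrak{h}$ and all $x_1,\dots,x_{k-1}$ in the algebra. The derived series of an ideal $\mathfrak{h}$ is $D^0(\mathfrak{h})=\mathfrak{h}$, $D^{p+1}(\mathfrak{h})=[D^p(\mathfrak{h}),\dots,D^p(\mathfrak{h})]$ (the bracket of subspaces is the span of all brackets of their elements). The ideal $\mathfrak{h}$ is solvable if $D^p(\mathfrak{h})=\{0\}$ for some $p\in\mathbb{N}$; a $k$-Lie superalgebra is solvable if it is solvable as an ideal of itself. *)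

(* Defs.v *)
From mathcomp Require Import all_boot all_algebra.
From mathcomp Require Import perm.

Set Implicit Arguments.
Unset Strict Implicit.
Unset Printing Implicit Defensive.

Import GRing.Theory.
Local Open Scope ring_scope.

Record superspace (K : fieldType) := Superspace {
  evenpart : lmodType K;
  oddpart : lmodType K
}.

Definition supercarrier (K : fieldType) (V : superspace K) : lmodType K :=
  (evenpart V * oddpart V)%type.

Coercion supercarrier : superspace >-> GRing.Lmodule.type.

(* Parities are booleans (true = odd) and are added with addb. *)

Definition evenodd_proj (K : fieldType) (V : superspace K) (a : bool) (v : V)
  : V := if a then (0, v.2) else (v.1, 0).

(* "v is homogeneous of parity a"; the vector 0 has both parities. *)
Definition homog (K : fieldType) (V : superspace K) (a : bool) (v : V) : Prop :=
  evenodd_proj a v = v.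

(* The sum of the first i parities, |x|_i. *)
Definition prefix_parity (n : nat) (a : {ffun 'I_n -> bool}) (i : nat) : bool :=
  \big[addb/false]_(j < n | (j < i)%N) a j.

Section Families.
Variables (V : choiceType) (n : nat).

Definition replace (x : {ffun 'I_n -> V}) (i : 'I_n) (v : V)
  : {ffun 'I_n -> V} := [ffun j => if j == i then v else x j].

(* (y_1, ..., y_{n-1}, v) *)
Definition append (y : {ffun 'I_n.-1 -> V}) (v : V) : {ffun 'I_n -> V} :=
  [ffun j : 'I_n => if insub (val j) is Some k then y k else v].

Definition swap (x : {ffun 'I_n -> V}) (i j : 'I_n) : {ffun 'I_n -> V} :=
  [ffun k => x (tperm i j k)].

Definition delete (x : {ffun 'I_n.+1 -> V}) (i : 'I_n.+1)
  : {ffun 'I_n -> V} := [ffun j => x (lift i j)].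

End Families.

Definition multilinear (K : fieldType) (V : lmodType K) (n : nat)
    (br : {ffun 'I_n -> V} -> V) : Prop :=
  forall (x : {ffun 'I_n -> V}) (i : 'I_n) (c : K) (u v : V),
    br (replace x i (c *: u + v)) =
      c *: br (replace x i u) + br (replace x i v).

(* The condition 2 <= n is not part of the record. *)
Record nLieSuperalgebra (K : fieldType) (n : nat) := NLieSuperalgebra {
  superspace_of :> superspace K;
  bracket : {ffun 'I_n -> superspace_of} -> superspace_of;
  bracket_multilinear : multilinear bracket;
  bracket_parity : forall (x : {ffun 'I_n -> superspace_of})
      (a : {ffun 'I_n -> bool}),
    (forall i, homog (a i) (x i)) ->
    homog (prefix_parity a n) (bracket x);
  bracket_skew : forall (x : {ffun 'I_n -> superspace_of})
      (a : {ffun 'I_n -> bool}) (i j : 'I_n),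
    (forall k, homog (a k) (x k)) -> j = i.+1 :> nat ->
    bracket x = - ((-1) ^+ (a i && a j) *: bracket (swap x i j));
  bracket_Filippov : forall (x : {ffun 'I_n -> superspace_of})
      (y : {ffun 'I_n.-1 -> superspace_of})
      (a : {ffun 'I_n -> bool}) (b : {ffun 'I_n.-1 -> bool}),
    (forall i, homog (a i) (x i)) -> (forall i, homog (b i) (y i)) ->
    bracket (append y (bracket x)) =
      \sum_(i < n) (-1) ^+ (prefix_parity a i && prefix_parity b n.-1) *:
        bracket (replace x i (bracket (append y (x i))))
}.

Definition supertrace (K : fieldType) (n : nat) (g : nLieSuperalgebra K n)
    (S : {scalar g}) : Prop :=
  (forall x : {ffun 'I_n -> g}, S (bracket x) = 0) /\
  (forall v : g, homog true v -> S v = 0).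

Section Induced.
Variables (K : fieldType) (n : nat) (g : nLieSuperalgebra K n) (S : {scalar g}).

(* The defining formula of the induced bracket for x_i homogeneous of
   parity a i.  Indices start at 0, so (-1)^(i-1) becomes (-1) ^+ i and
   |x|_{i-1} becomes prefix_parity a i. *)
Definition induced_formula (a : {ffun 'I_n.+1 -> bool})
    (x : {ffun 'I_n.+1 -> g}) : g :=
  \sum_(i < n.+1)
    ((-1) ^+ i * (-1) ^+ (a i && prefix_parity a i) * S (x i)) *:
      bracket (delete x i).

(* The extension of induced_formula by multilinearity: every argument is split
   into its even and odd components.  See induced_bracket_homog and
   induced_bracket_multilinear. *)
Definition induced_bracket (x : {ffun 'I_n.+1 -> g}) : g :=
  \sum_(a : {ffun 'I_n.+1 -> bool})
    induced_formula a [ffun i => evenodd_proj (a i) (x i)].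

Lemma bracket_eq0 (x : {ffun 'I_n -> g}) i : x i = 0 -> bracket x = 0.
Proof.
move=> xi0.
have Ex u : u = 0 -> replace x i u = x.
  by move=> ->; apply/ffunP=> j; rewrite ffunE; case: eqP => // ->.
have := bracket_multilinear x i (-1) 0 0.
by rewrite scaleN1r oppr0 addr0 Ex // scaleN1r addNr.
Qed.

Lemma induced_bracket_homog (a : {ffun 'I_n.+1 -> bool})
    (x : {ffun 'I_n.+1 -> g}) :
  (forall i, homog (a i) (x i)) -> induced_bracket x = induced_formula a x.
Proof.
move=> hx; rewrite /induced_bracket (bigD1 a) //= [X in _ + X]big1 ?addr0.
  by congr induced_formula; apply/ffunP=> i; rewrite ffunE hx.
move=> b neq_ba; have [k neq_k] : exists k, b k != a k.
  apply/existsP; rewrite -negb_forall; apply: contra neq_ba => /forallP eqba.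
  by apply/eqP/ffunP => k; apply/eqP.
have pk0 : evenodd_proj (b k) (x k) = 0.
  rewrite -(hx k); move: (b k) (a k) neq_k.
  by case; case=> // _; rewrite /evenodd_proj /=.
apply: big1 => i _; case: (unliftP i k) => [j|] Ek.
  by rewrite (@bracket_eq0 _ j) ?scaler0 // !ffunE -Ek.
by rewrite ffunE -Ek pk0 raddf0 mulr0 scale0r.
Qed.

Lemma induced_bracket_multilinear : multilinear induced_bracket.
Proof.
move=> x k c u v; rewrite /induced_bracket scaler_sumr -big_split /=.
apply: eq_bigr => a _; rewrite /induced_formula scaler_sumr -big_split /=.
have projD : evenodd_proj (a k) (c *: u + v) =
    c *: evenodd_proj (a k) u + evenodd_proj (a k) v.
  by case: (a k); rewrite /evenodd_proj; congr (_, _); rewrite /= ?scaler0 ?addr0.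
apply: eq_bigr => i _; rewrite !ffunE.
case: (unliftP i k) => [j|] Ek; last first.
  have Ed w w' : delete [ffun i0 => evenodd_proj (a i0) (replace x k w i0)] i =
      delete [ffun i0 => evenodd_proj (a i0) (replace x k w' i0)] i.
    by apply/ffunP=> l; rewrite !ffunE Ek eq_sym (negPf (neq_lift _ _)).
  rewrite (Ed _ 0) (Ed u 0) (Ed v 0) -Ek eqxx projD.
  by rewrite linearP /= mulrDr scalerDl scalerA; congr (_ *: _ + _); rewrite mulrCA.
rewrite Ek (negPf (neq_lift i j)).
pose d := delete [ffun i0 => evenodd_proj (a i0) (x i0)] i.
have Ed w : delete [ffun i0 => evenodd_proj (a i0) (replace x (lift i j) w i0)] i
    = replace d j (evenodd_proj (a k) w).
  apply/ffunP=> l; rewrite !ffunE (inj_eq lift_inj).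
  by case: eqP => // ->; rewrite Ek.
by rewrite !Ed projD bracket_multilinear scalerDr !scalerA [c * _]mulrC.
Qed.

End Induced.

(* The notions below depend only on the vector space and the k-ary bracket. *)
Section Solvability.
Variables (K : fieldType) (V : lmodType K) (k : nat).
Variable br : {ffun 'I_k -> V} -> V.

Definition subspace (h : V -> Prop) : Prop :=
  h 0 /\ forall (c : K) (u v : V), h u -> h v -> h (c *: u + v).

Definition span (A : V -> Prop) (v : V) : Prop :=
  exists s : seq (K * V),
    (forall p, p \in s -> A p.2) /\ v = \sum_(p <- s) p.1 *: p.2.

Definition ideal (h : V -> Prop) : Prop :=
  subspace h /\
  forall (x : {ffun 'I_k -> V}) (i : 'I_k), i = 0%N :> nat ->
    h (x i) -> h (br x).

Definition bracket_of_subspace (h : V -> Prop) : V -> Prop :=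
  span (fun v => exists x : {ffun 'I_k -> V}, (forall i, h (x i)) /\ v = br x).

Definition derived_series (h : V -> Prop) (p : nat) : V -> Prop :=
  iter p bracket_of_subspace h.

Definition solvable_ideal (h : V -> Prop) : Prop :=
  ideal h /\ exists p : nat, forall v : V, derived_series h p v <-> v = 0.

Definition solvable : Prop := solvable_ideal (fun _ : V => True).

End Solvability.

(* Main.v *)
Require Import Defs.
From mathcomp Require Import all_boot all_algebra.

Import GRing.Theory.
Local Open Scope ring_scope.

(** The derived series reaches zero after two steps.  Every term of an induced
    bracket is a scalar times a value of the original bracket, on which the
    supertrace [S] vanishes; hence the first derived term lies in the kernel of
    [S] ([supertrace_induced_bracket]).  Conversely, every term of an induced
    bracket carries a factor [S (x i)], so the induced bracket vanishes on
    arguments from that kernel ([induced_bracket_ker]), and the second derived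
    term is zero.  The one point needing care is that the induced bracket splits
    its arguments into homogeneous components: the kernel of [S] is stable under
    this splitting because [S] vanishes on odd vectors ([supertrace_proj]). *)

Lemma span_min (K : fieldType) (V : lmodType K) (A h : V -> Prop) (v : V) :
  subspace h -> (forall w, A w -> h w) -> Defs.span A v -> h v.
Proof.
move=> [h0 hZD] sAh [s [sA ->]].
elim: s sA => [|p s IHs] sA; first by rewrite big_nil.
rewrite big_cons; apply: hZD; first by apply/sAh/sA; rewrite mem_head.
by apply: IHs => q sq; apply: sA; rewrite inE sq orbT.
Qed.

Lemma span0 (K : fieldType) (V : lmodType K) (A : V -> Prop) : Defs.span A 0.
Proof. by exists [::]; rewrite big_nil. Qed.

Section InducedBracket.
Variables (K : fieldType) (n : nat) (g : nLieSuperalgebra K n) (S : {scalar g}).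
Hypothesis hS : supertrace S.

(** As [S] vanishes on the odd component, it takes the same value on [v] and on
    its even component. *)
Lemma supertrace_proj (a : bool) (v : g) : S v = 0 -> S (evenodd_proj a v) = 0.
Proof.
have [_ Sodd] := hS; have Sodd0 : S (evenodd_proj true v) = 0 by exact: Sodd.
case: a => // Sv0.
have Dv : v = evenodd_proj false v + evenodd_proj true v.
  by case: v {Sodd0 Sv0} => v0 v1; congr (_, _); rewrite /= ?addr0 ?add0r.
by move: Sv0; rewrite {1}Dv linearD /= Sodd0 addr0.
Qed.

Lemma supertrace_induced_bracket (x : {ffun 'I_n.+1 -> g}) :
  S (induced_bracket S x) = 0.
Proof.
have [Sbr _] := hS.
rewrite linear_sum big1 // => a _; rewrite linear_sum big1 // => i _.
by rewrite linearZ /= Sbr mulr0.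
Qed.

Lemma induced_bracket_ker (x : {ffun 'I_n.+1 -> g}) :
  (forall i, S (x i) = 0) -> induced_bracket S x = 0.
Proof.
move=> Sx0; apply: big1 => a _; apply: big1 => i _.
by rewrite ffunE supertrace_proj // mulr0 scale0r.
Qed.

End InducedBracket.

Theorem proposition3 (K : fieldType) (n : nat) (hn : (2 <= n)%N)
    (g : nLieSuperalgebra K n) (S : {scalar g}) (hS : supertrace S) :
  solvable (induced_bracket S).
Proof.
split; first by [].
exists 2%N => v; split=> [|->]; last exact: span0.
apply: (@span_min _ _ _ (fun w => w = 0)).
  by split=> // c u w -> ->; rewrite scaler0 addr0.
move=> _ [x [D1x ->]]; apply: induced_bracket_ker => // i.
apply: (@span_min _ _ _ (fun w => S w = 0) _ _ _ (D1x i)) => [|_ [y [_ ->]]].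
  split=> [|c u w Su0 Sw0]; first by rewrite raddf0.
  by rewrite linearP /= Su0 Sw0 mulr0 addr0.
exact: supertrace_induced_bracket.
Qed.
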